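(* Let $(G_n)_{n\in\mathbb{N}}$ be an $\mathrm{FO}$-convergent sequence of finite graphs with a modeling limit $L$, and let $r$ be an algebraic vertex of $L$. Then there is a sequence $(r_n)_{n\in\mathbb{N}}$ with $r_n \in V(G_n)$ such that $(G_n, r_n)$ $\mathrm{FO}$-converges to $(L, r)$, i.e. $\lim_{n\to\infty} \langle \phi, (G_n,r_n)\rangle = \langle \phi, (L,r)\rangle$ for every first-order formula $\phi$ in the language of rooted graphs.
   Context: Graphs are considered as first-order structures in the language with one binary (edge) relation. $\mathrm{FO}_p$ denotes the set of first-order formulas with $p$ free variables in the language of graphs. For $\phi\in\mathrm{FO}_p$ and a structure $G$, $\phi(G)=\{\mathbf{v}\in V(G)^p : G\models\phi(\mathbf{v})\}$. The Stone pairing of $\phi \in \mathrm{FO}_p$, $p\ge 1$, with a finite graph $G$ is $\langle \phi, G\rangle = |\phi(G)|/|V(G)|^p$, the probability that a uniformly random $p$-tuple of vertices satisfies $\phi$; for a sentence ($p=0$), $\langle\phi,G\rangle=1$ if $G\models\phi$ and $0$ otherwise. A sequence of finite graphs $(G_n)$ is $\mathrm{FO}$-convergent if $(\langle\phi,G_n\rangle)$ converges for every formula $\phi$. A modeling is a graph $L$ whose vertex set is a standard Borel space equipped with a probability measure $\nu$ such that every first-order definable set $\phi(L)\subseteq V(L)^p$ is measurable (in the product $\sigma$-algebra); one sets $\langle\phi,L\rangle=\nu^{\otimes p}(\phi(L))$ (and $1$ or $0$ for sentences according to truth). $L$ is a modeling limit of $(G_n)$ if $\lim_n\langle\phi,G_n\rangle=\langle\phi,L\rangle$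 for all formulas $\phi$. The language of rooted graphs extends the language of graphs by a constant symbol $\mathrm{Root}$; $(G,r)$ denotes $G$ with $\mathrm{Root}$ interpreted as the vertex $r$, and Stone pairings of formulas of this extended language with $(G,r)$ or $(L,r)$ are defined in the same way. A formula $\xi(x)$ with one free variable is algebraic in $L$ if $\xi(L)$ is finite; a vertex of $L$ is algebraic if it belongs to $\xi(L)$ for some formula $\xi(x)$ (of the language of graphs) algebraic in $L$. *)

(* Defs.v *)
From HB Require Import structures.
From mathcomp Require Import all_boot all_order all_algebra.
From mathcomp Require Import all_classical all_reals.
From mathcomp Require Import ereal topology normedtype sequences measure lebesgue_integral.
Set Implicit Arguments. Unset Strict Implicit. Unset Printing Implicit Defensive.
Import Order.TTheory GRing.Theory Num.Theory.
Import numFieldNormedType.Exports.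
Local Open Scope classical_set_scope.
Local Open Scope ring_scope.

(* C = void : language of graphs;  C = unit : language of rooted      *)
(* graphs (the unique constant tt is Root).                           *)
(* formula C p = formulas whose free variables are among x_0..x_{p-1} *)
(* (i.e. FO_p); FEx binds the new variable x_p.                       *)
Inductive term (C : Type) (n : nat) : Type :=
| TVar of 'I_n
| TConst of C.

Inductive formula (C : Type) : nat -> Type :=
| FEq n : term C n -> term C n -> formula C n
| FAdj n : term C n -> term C n -> formula C n
| FNot n : formula C n -> formula C n
| FAnd n : formula C n -> formula C n -> formula C n
| FEx n : formula C n.+1 -> formula C n.

Section Semantics.
Variables (C : Type) (V : Type) (adj : V -> V -> bool) (ic : C -> V).

Definition eval_term n (e : 'I_n -> V) (t : term C n) : V :=
  match t with TVar i => e i | TConst c => ic c end.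

Definition env_ext n (e : 'I_n -> V) (v : V) (i : 'I_n.+1) : V :=
  match unlift ord_max i with Some j => e j | None => v end.

Fixpoint sat n (e : 'I_n -> V) (phi : formula C n) {struct phi} : Prop :=
  match phi in formula _ m return ('I_m -> V) -> Prop with
  | FEq m t1 t2 => fun e => eval_term e t1 = eval_term e t2
  | FAdj m t1 t2 => fun e => adj (eval_term e t1) (eval_term e t2)
  | FNot m f => fun e => ~ sat e f
  | FAnd m f g => fun e => sat e f /\ sat e g
  | FEx m f => fun e => exists v : V, sat (env_ext e v) f
  end e.

Definition def_set p (phi : formula C p) : set (p.-tuple V) :=
  [set t | sat (tnth t) phi].

End Semantics.

Definition of_void (V : Type) (x : void) : V := match x with end.

Definition is_graph (V : Type) (adj : V -> V -> bool) : Prop :=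
  (forall x y, adj x y = adj y x) /\ (forall x, ~~ adj x x).

Record fingraph := FinGraph { fg_V : finType; fg_adj : rel fg_V }.

Definition is_fingraph (G : fingraph) : Prop :=
  is_graph (@fg_adj G) /\ (0 < #|fg_V G|)%N.

Definition fpair (R : realType) (C : Type) (G : fingraph) (ic : C -> fg_V G)
    (p : nat) (phi : formula C p) : R :=
  (#|[set t : p.-tuple (fg_V G) | `[< sat (@fg_adj G) ic (tnth t) phi >] ]|%:R
     / (#|fg_V G| ^ p)%:R).

(* Standard Borel space: isomorphic (as a measurable space) to a Polish
   space with its Borel sigma-algebra.  A Polish space is presented as a
   complete metric space (complete pseudometric + Hausdorff) that is
   separable. *)
Definition standard_borel (R : realType) d (T : measurableType d) : Prop :=
  exists (P : completePseudoMetricType R) (f : T -> P),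
    [/\ hausdorff_space P,
        (exists S : set P, countable S /\ dense S),
        bijective f &
        forall A : set T, measurable A <->
          exists B : set P, smallest (sigma_algebra setT) (@open P) B /\
                            A = f @^-1` B].

(* the p-fold product measure nu^{(x) p} on p-tuples, built by iterating
   the construction of the library's product measure
   (m1 \x m2) A = \int[m1]_x m2 (xsection A x). *)
Fixpoint prodm (R : realType) d (T : measurableType d) (nu : probability T R)
    (p : nat) : set (p.-tuple T) -> \bar R :=
  match p return set (p.-tuple T) -> \bar R with
  | 0 => fun A => (if `[< A [tuple] >] then 1 else 0)%E
  | p'.+1 => fun A =>
      (\int[nu]_x prodm nu [set t : p'.-tuple T | A (cons_tuple x t)])%E
  end.

Definition mpair (R : realType) d (T : measurableType d) (nu : probability T R)
    (adj : T -> T -> bool) (C : Type) (ic : C -> T) (p : nat)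
    (phi : formula C p) : \bar R :=
  prodm nu (def_set adj ic phi).

Definition is_modeling (R : realType) d (T : measurableType d)
    (nu : probability T R) (adj : T -> T -> bool) : Prop :=
  [/\ standard_borel R T, is_graph adj &
      forall p (phi : formula void p), measurable (def_set adj (@of_void T) phi)].

Definition FO_convergent (R : realType) (G : nat -> fingraph) : Prop :=
  forall p (phi : formula void p),
    cvg ((fun n => fpair R (@of_void (fg_V (G n))) phi) @ \oo).

Definition modeling_limit (R : realType) (G : nat -> fingraph) d
    (T : measurableType d) (nu : probability T R) (adj : T -> T -> bool) : Prop :=
  forall p (phi : formula void p),
    (fun n => (fpair R (@of_void (fg_V (G n))) phi)%:E) @ \oo
      --> mpair nu adj (@of_void T) phi.

Definition algebraic_vertex d (T : measurableType d) (adj : T -> T -> bool)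
    (r : T) : Prop :=
  exists xi : formula void 1,
    finite_set (def_set adj (@of_void T) xi) /\ def_set adj (@of_void T) xi [tuple r].

(* Main.v *)
(* Let xi be a formula with xi(L) finite and r in xi(L), and put k = |xi(L)|.
   For a formula phi(x, y), the number of x in xi with phi(x, y) is the sum over
   j < k of the indicators of the formulas "more than j elements x of xi satisfy
   phi(x, y)", as soon as xi has at most k solutions, which holds in G_n for n
   large. Hence the sum over v in xi(G_n) of <phi, (G_n, v)> converges to the
   corresponding sum over xi(L). Conjunction of formulas on disjoint variables
   multiplies Stone pairings, so the same is true with <phi, (_, v)> replaced by
   any polynomial in finitely many pairings. Apply this to (1 - Q / M) ^ N, with Q
   the squared distance of the pairings at v to those at r: the sum is at least 1
   in L, whereas it would be small in G_n for N large if every v in xi(G_n) had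
   pairings far from those of r. So finitely many pairings can be approximated,
   and a diagonal argument over the countably many formulas gives (r_n). *)
Require Import Defs.
From HB Require Import structures.
From mathcomp Require Import all_boot all_order all_algebra.
From mathcomp Require Import all_classical all_reals.
From mathcomp Require Import ereal topology normedtype sequences measure lebesgue_integral.
From mathcomp Require Import numfun measurable_realfun random_variable.
From mathcomp Require Import lra.
(* Otherwise [of_void] is the one of mathcomp's ssrfun. *)
Import Defs.
Set Implicit Arguments. Unset Strict Implicit. Unset Printing Implicit Defensive.
Import Order.TTheory GRing.Theory Num.Theory.
Import numFieldNormedType.Exports.
Local Open Scope classical_set_scope.
Local Open Scope ring_scope.

(** * Substitution, and conjunction on disjoint variables *)

Definition shift_term C n (t : term C n) : term C n.+1 :=
  match t with TVar i => TVar _ (lift ord_max i) | TConst c => TConst _ c end.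

(** The quantified variable is always the last one, so passing under [FEx] fixes [ord_max] and keeps
    the numbers of all other variables. *)
Definition lift_subst C n m (s : 'I_n -> term C m) (i : 'I_n.+1) : term C m.+1 :=
  if unlift ord_max i is Some j then shift_term (s j) else TVar _ ord_max.

Definition subst_term C D n m (s : 'I_n -> term D m) (c : C -> term D m)
    (t : term C n) : term D m :=
  match t with TVar i => s i | TConst x => c x end.

(** Constants are replaced too, and the language may change: this is what lets Root become a
    variable. *)
Fixpoint subst C D n (phi : formula C n) :
    forall m, ('I_n -> term D m) -> (C -> term D m) -> formula D m :=
  match phi with
  | FEq _ t u => fun m s c => FEq (subst_term s c t) (subst_term s c u)
  | FAdj _ t u => fun m s c => FAdj (subst_term s c t) (subst_term s c u)
  | FNot _ f => fun m s c => FNot (subst f s c)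
  | FAnd _ f g => fun m s c => FAnd (subst f s c) (subst g s c)
  | FEx _ f => fun m s c => FEx (subst f (lift_subst s) (@shift_term _ _ \o c))
  end.

Lemma env_ext_max V n (e : 'I_n -> V) v : env_ext e v ord_max = v.
Proof. by rewrite /env_ext unlift_none. Qed.

Lemma env_ext_lift V n (e : 'I_n -> V) v i : env_ext e v (lift ord_max i) = e i.
Proof. by rewrite /env_ext liftK. Qed.

Lemma eval_shift_term C V (ic : C -> V) n (e : 'I_n -> V) v (t : term C n) :
  eval_term ic (env_ext e v) (shift_term t) = eval_term ic e t.
Proof. by case: t => //= i; rewrite env_ext_lift. Qed.

Lemma sat_subst C D V adj (ic : D -> V) n (phi : formula C n) m
    (s : 'I_n -> term D m) (c : C -> term D m) (e : 'I_m -> V) :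
  sat adj ic e (subst phi s c) <->
  sat adj (eval_term ic e \o c) (eval_term ic e \o s) phi.
Proof.
have eval_subst k l (s' : 'I_k -> term D l) c' e' (t : term C k) :
    eval_term ic e' (subst_term s' c' t) =
    eval_term (eval_term ic e' \o c') (eval_term ic e' \o s') t by case: t.
elim: phi m s c e => {n} [n t u|n t u|n f IH|n f IHf g IHg|n f IH] m s c e /=.
- by rewrite !eval_subst.
- by rewrite !eval_subst.
- by rewrite IH.
- by rewrite IHf IHg.
have E1 v : eval_term ic (env_ext e v) \o (@shift_term _ _ \o c) = eval_term ic e \o c.
  by apply/funext => x; rewrite /= eval_shift_term.
have E2 v : eval_term ic (env_ext e v) \o lift_subst s = env_ext (eval_term ic e \o s) v.
  apply/funext => i; rewrite /= /lift_subst [RHS]/env_ext.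
  by case: unliftP => [j _|_] /=; rewrite ?eval_shift_term ?env_ext_max.
by split=> -[v fv]; exists v; [rewrite -(E1 v) -E2; exact/IH|apply/IH; rewrite E1 E2].
Qed.

Definition FConj C p q (phi : formula C p) (psi : formula C q) : formula C (p + q) :=
  FAnd (subst phi (fun i => TVar _ (lshift q i)) (@TConst _ _))
       (subst psi (fun i => TVar _ (rshift p i)) (@TConst _ _)).

Lemma sat_FConj C V adj (ic : C -> V) p q (phi : formula C p) (psi : formula C q) e :
  sat adj ic e (FConj phi psi) <->
  sat adj ic (e \o @lshift p q) phi /\ sat adj ic (e \o @rshift p q) psi.
Proof. by rewrite /= !sat_subst. Qed.

Lemma sat_FConj_tuple C V adj (ic : C -> V) p q (phi : formula C p)
    (psi : formula C q) (t : (p + q).-tuple V) :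
  sat adj ic (tnth t) (FConj phi psi) <->
  sat adj ic (tnth [tuple tnth t (lshift q i) | i < p]) phi /\
  sat adj ic (tnth [tuple tnth t (rshift p i) | i < q]) psi.
Proof.
rewrite sat_FConj.
have -> : tnth t \o lshift q = tnth [tuple tnth t (lshift q i) | i < p].
  by apply/funext => i; rewrite tnth_mktuple.
have -> : tnth t \o @rshift p q = tnth [tuple tnth t (rshift p i) | i < q].
  by apply/funext => i; rewrite tnth_mktuple.
by [].
Qed.

(** * Trading the root for a variable, and counting solutions by formulas *)

(** Root becomes the last variable, the one that [FEx] and [FMore] bind. *)
Definition unroot p (phi : formula unit p) : formula void p.+1 :=
  subst phi (fun i => TVar _ (lift ord_max i)) (fun _ => TVar _ ord_max).

Lemma sat_unroot V adj p (phi : formula unit p) (e : 'I_p -> V) v :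
  sat adj (@of_void V) (env_ext e v) (unroot phi) <-> sat adj (fun _ => v) e phi.
Proof.
rewrite sat_subst.
have -> : eval_term (@of_void V) (env_ext e v) \o (fun _ : unit => TVar void ord_max) = fun=> v.
  by apply/funext => _ /=; rewrite env_ext_max.
by have -> : eval_term (@of_void V) (env_ext e v) \o (fun i => TVar void (lift ord_max i)) = e
  by apply/funext => i /=; rewrite env_ext_lift.
Qed.

Definition last_var p (xi : formula void 1) : formula void p.+1 :=
  subst xi (fun _ => TVar _ ord_max) (@of_void _).

Lemma sat_last_var V adj p (xi : formula void 1) (e : 'I_p -> V) v :
  sat adj (@of_void V) (env_ext e v) (last_var p xi) <->
  sat adj (@of_void V) (fun _ => v) xi.
Proof.
rewrite sat_subst.
have -> : eval_term (@of_void V) (env_ext e v) \o @of_void _ = @of_void V.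
  by apply: funext => -[].
by have -> : eval_term (@of_void V) (env_ext e v) \o (fun _ : 'I_1 => TVar void ord_max) = fun=> v
  by apply/funext => i /=; rewrite env_ext_max.
Qed.

(* [phi] holds at the last variable, which differs from the one before it. *)
Definition FOther p (phi : formula void p.+1) : formula void p.+2 :=
  FAnd (subst phi (lift_subst (fun i => TVar _ (lift ord_max i))) (@TConst _ _))
       (FNot (FEq (TVar _ ord_max) (TVar _ (lift ord_max ord_max)))).

(** More than [j] values of the last variable satisfy [phi]: one value is picked, and the recursion
    counts those different from it. *)
Fixpoint FMore j : forall p, formula void p.+1 -> formula void p :=
  match j with
  | 0 => @FEx void
  | j'.+1 => fun p phi => FEx (FAnd phi (FMore j' (FOther phi)))
  end.

(** The list [s] contains all solutions, which gives a count even when [V] is infinite. Induction on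
    [j], for all [phi] at once. *)
Lemma sat_FMore (V : eqType) adj j p (phi : formula void p.+1) (e : 'I_p -> V) (s : seq V) :
  uniq s -> (forall v, sat adj (@of_void V) (env_ext e v) phi -> v \in s) ->
  sat adj (@of_void V) e (FMore j phi) <->
  (j < count (fun v => `[< sat adj (@of_void V) (env_ext e v) phi >]) s)%N.
Proof.
move=> us; elim: j p phi e => [|j IH] p phi e phis /=.
  rewrite -has_count; split=> [[v phiv]|/hasP[v _ /asboolP]]; last by exists v.
  by apply/hasP; exists v; [exact: phis|exact/asboolP].
pose P v := `[< sat adj (@of_void V) (env_ext e v) phi >].
have satE v w : sat adj (@of_void V) (env_ext (env_ext e v) w) (FOther phi) <->
   P w && (w != v).
  rewrite /= sat_subst env_ext_lift !env_ext_max.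
  have -> : eval_term (@of_void V) (env_ext (env_ext e v) w) \o @TConst _ _ = @of_void V
    by apply: funext => -[].
  have -> : eval_term (@of_void V) (env_ext (env_ext e v) w) \o
      lift_subst (fun i => TVar _ (lift ord_max i)) = env_ext e w.
    apply/funext => i /=; rewrite /lift_subst; case: unliftP => [k ->|->] /=.
      by rewrite !env_ext_lift.
    by rewrite !env_ext_max.
  split=> [[/asboolP Pw /eqP wv]|/andP[/asboolP Pw /eqP wv]]; [exact/andP|by split].
(* Excluding the chosen solution [v] lowers the count by exactly one, [s] being duplicate-free. *)
have countE v : P v -> v \in s ->
    (count (fun w => `[< sat adj (@of_void V) (env_ext (env_ext e v) w) (FOther phi) >]) s).+1 =
    count P s.
  move=> Pv vs.
  rewrite (eq_count (a2 := fun w => P w && (w != v))); last first.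
    by move=> w; apply/asboolP/idP => /satE.
  have vf : v \in seq.filter P s by rewrite mem_filter Pv.
  rewrite -(size_filter P) (perm_size (perm_to_rem vf)) /= rem_filter ?filter_uniq //.
  rewrite -filter_predI size_filter; congr _.+1.
  by apply: eq_count => w /=; rewrite andbC.
have sub v w : sat adj (@of_void V) (env_ext (env_ext e v) w) (FOther phi) -> w \in s.
  by move=> /satE /andP[/asboolP /phis].
split=> [[v [phiv]]|].
  move/(IH _ _ _ (sub v)).
  by rewrite -(countE v) //; [exact/asboolP|exact: phis].
move=> jc; have /hasP[v vs Pv] : has P s by rewrite has_count; exact: leq_ltn_trans jc.
exists v; split; first exact/asboolP.
by apply/(IH _ _ _ (sub v)); rewrite -ltnS countE.
Qed.

Definition FMore_in (xi : formula void 1) j p (phi : formula unit p) : formula void p :=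
  FMore j (FAnd (last_var p xi) (unroot phi)).

(** Writes a count as a sum of threshold indicators, each of which is expressible by a formula. *)
Lemma sum_ltn k c : (c <= k)%N -> (\sum_(j < k) (j < c) = c)%N.
Proof.
elim: k => [|k IH]; first by rewrite leqn0 => /eqP->; rewrite big_ord0.
rewrite big_ord_recr /= leq_eqVlt => /predU1P[->|]; last first.
  by rewrite ltnS => ck; rewrite IH // ltnNge ck addn0.
rewrite ltnSn addn1; congr _.+1; rewrite -[RHS](card_ord k) -sum1_card; apply: eq_bigr => i _.
by rewrite (ltn_trans (ltn_ord i)).
Qed.

(** The left side counts the solutions [v] of [xi] at which [phi] holds; the right side sums
    thresholds of that count and no longer mentions a root. Being pointwise in [e], the identity can
    be averaged over tuples in a finite graph and in a modeling alike. *)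
Lemma sum_sat_FMore_in (V : eqType) adj xi (s : seq V) k p (phi : formula unit p) e :
  uniq s -> (forall v, sat adj (@of_void V) (fun=> v) xi <-> v \in s) -> (size s <= k)%N ->
  (\sum_(v <- s) `[< sat adj (fun=> v) e phi >] =
   \sum_(j < k) `[< sat adj (@of_void V) e (FMore_in xi j phi) >])%N.
Proof.
move=> us xis sk.
have satE v : sat adj (@of_void V) (env_ext e v) (FAnd (last_var p xi) (unroot phi)) <->
    v \in s /\ sat adj (fun=> v) e phi.
  by rewrite /= sat_last_var sat_unroot xis.
set c := count (fun v => `[< sat adj (@of_void V) (env_ext e v)
   (FAnd (last_var p xi) (unroot phi)) >]) s.
transitivity c.
  rewrite /c -sum1_count [RHS]big_mkcond /= !big_seq; apply: eq_bigr => v vs.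
  have -> : `[< sat adj (fun=> v) e phi >] =
      `[< sat adj (@of_void V) (env_ext e v) (FAnd (last_var p xi) (unroot phi)) >].
    by apply: asbool_equiv_eq; rewrite satE; split=> [|[]].
  by case: asboolP.
rewrite -[LHS](@sum_ltn k) ?(leq_trans (count_size _ _)) //.
apply: eq_bigr => j _; congr nat_of_bool.
rewrite -[LHS]asboolb; apply: asbool_equiv_eq; symmetry.
by apply: sat_FMore => // v /satE[].
Qed.

(** * Stone pairings with finite graphs *)

Lemma mem_set_asbool T (P : T -> Prop) t : (t \in [set u | `[< P u >]]) = `[< P t >].
Proof. by apply/idP/idP; rewrite inE. Qed.

(** Cutting a tuple after its first [p] entries is a bijection onto pairs of tuples. *)
Lemma card_tuple_cat (V : finType) p q (A : {pred p.-tuple V}) (B : {pred q.-tuple V}) :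
  #|[pred t : (p + q).-tuple V | ([tuple tnth t (lshift q i) | i < p] \in A) &&
                                 ([tuple tnth t (rshift p i) | i < q] \in B)]| =
  (#|A| * #|B|)%N.
Proof.
rewrite -cardX.
pose f (t : (p + q).-tuple V) :=
  ([tuple tnth t (lshift q i) | i < p], [tuple tnth t (rshift p i) | i < q]).
have f_inj : injective f.
  move=> t u tu; apply: eq_from_tnth => i; rewrite -(splitK i).
  case: (fintype.split i) => j /=.
    by have /(congr1 (fun w => tnth w j)) := congr1 fst tu; rewrite !tnth_mktuple.
  by have /(congr1 (fun w => tnth w j)) := congr1 snd tu; rewrite !tnth_mktuple.
rewrite -(fintype.card_image f_inj); apply: eq_card => -[a b].
apply/fintype.imageP/andP => [[t]|[/= aA bB]].
  by rewrite inE => /andP[tA tB] [-> ->].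
pose t := [tuple match fintype.split i with inl j => tnth a j | inr j => tnth b j end | i < p + q].
have ta : [tuple tnth t (lshift q i) | i < p] = a.
  apply: eq_from_tnth => i; rewrite !tnth_mktuple.
  by rewrite -[lshift q i]/(unsplit (inl i)) unsplitK.
have tb : [tuple tnth t (rshift p i) | i < q] = b.
  apply: eq_from_tnth => i; rewrite !tnth_mktuple.
  by rewrite -[rshift p i]/(unsplit (inr i)) unsplitK.
by exists t; rewrite ?inE /f ta tb ?aA.
Qed.

Section FinitePairing.
Variables (R : realType) (G : fingraph).
Hypothesis G0 : (0 < #|fg_V G|)%N.

Lemma fpairE C (ic : C -> fg_V G) p (phi : formula C p) :
  fpair R ic phi =
  (\sum_(t : p.-tuple (fg_V G)) `[< sat (@fg_adj G) ic (tnth t) phi >])%:R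
    / (#|fg_V G| ^ p)%:R.
Proof.
rewrite /fpair -sum1_card big_mkcond /=; congr (_%:R / _).
by apply: eq_bigr => t _; rewrite mem_set_asbool; case: asboolP.
Qed.

Lemma fpair_ge0 C (ic : C -> fg_V G) p (phi : formula C p) : 0 <= fpair R ic phi.
Proof. by rewrite /fpair divr_ge0. Qed.

Lemma fpair_le1 C (ic : C -> fg_V G) p (phi : formula C p) : fpair R ic phi <= 1.
Proof.
rewrite /fpair ler_pdivrMr ?ltr0n ?expn_gt0 ?G0 // mul1r ler_nat.
by rewrite -card_tuple max_card.
Qed.

Lemma fpair_FConj C (ic : C -> fg_V G) p q (phi : formula C p) (psi : formula C q) :
  fpair R ic (FConj phi psi) = fpair R ic phi * fpair R ic psi.
Proof.
rewrite /fpair mulf_div -!natrM -expnD -card_tuple_cat; congr (_%:R / _).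
apply: eq_card => t; rewrite inE !mem_set_asbool -asbool_and; apply: asbool_equiv_eq.
exact: sat_FConj_tuple.
Qed.

Lemma fpair0 C (ic : C -> fg_V G) (phi : formula C 0) :
  fpair R ic phi = `[< sat (@fg_adj G) ic (tnth [tuple]) phi >]%:R.
Proof.
rewrite fpairE divr1 (bigD1 [tuple]) //= big1 ?addn0 // => t.
by rewrite tuple0.
Qed.

Lemma sum_fpair_FMore_in xi (s : seq (fg_V G)) k p (phi : formula unit p) :
  uniq s -> (forall v, sat (@fg_adj G) (@of_void _) (fun=> v) xi <-> v \in s) ->
  (size s <= k)%N ->
  \sum_(v <- s) fpair R (fun=> v) phi =
  \sum_(j < k) fpair R (@of_void (fg_V G)) (FMore_in xi j phi).
Proof.
move=> us xis sk; under eq_bigr do rewrite fpairE; rewrite -mulr_suml.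
under [in RHS]eq_bigr do rewrite fpairE; rewrite -[RHS]mulr_suml -!natr_sum; congr (_%:R / _).
rewrite exchange_big [RHS]exchange_big; apply: eq_bigr => t _.
exact: sum_sat_FMore_in.
Qed.
End FinitePairing.

(** * The iterated product measure on tuples *)

Definition cons_pair T p (x : T * p.-tuple T) : p.+1.-tuple T := cons_tuple x.1 x.2.

Lemma measurable_cons_pair d (T : measurableType d) p :
  measurable_fun [set: T * p.-tuple T] (@cons_pair T p).
Proof. exact: (measurable_cons measurable_fst measurable_snd). Qed.

HB.instance Definition _ d (T : measurableType d) p :=
  isMeasurableFun.Build _ _ _ _ (@cons_pair T p) (@measurable_cons_pair d T p).

Lemma measurable_preimageT d d' (T : measurableType d) (T' : measurableType d')
    (f : T -> T') (A : set T') :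
  measurable_fun setT f -> measurable A -> measurable (f @^-1` A).
Proof. by move=> mf mA; rewrite -[X in measurable X]setTI; exact: mf. Qed.

Section PowerMeasure.
Variables (R : realType) (d : measure_display) (T : measurableType d).
Variable nu : probability T R.
Local Open Scope ereal_scope.

(** [prodm] is a mere set function; on measurable sets it agrees with the image of [nu \x m] under
    [cons_pair], so the theory of measures applies. *)
Lemma prodm_probability p :
  exists m : probability (p.-tuple T) R, forall A, measurable A -> prodm nu A = m A.
Proof.
elim: p => [|p [m mE]].
  exists (dirac [tuple]) => A _ /=; rewrite diracE.
  by case: asboolP => At; [rewrite mem_set|rewrite memNset].
exists (distribution (nu \x m) (@cons_pair T p)) => A mA /=.
rewrite /distribution /pushforward /=; apply: eq_integral => x _ /=.
have sE : xsection (@cons_pair T p @^-1` A) x = [set t : p.-tuple T | A (cons_tuple x t)].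
  by apply/seteqP; split=> t /=; rewrite /xsection /= inE.
rewrite sE mE // -sE; apply: measurable_xsection.
exact: (measurable_preimageT (@measurable_cons_pair _ _ _) mA).
Qed.

Lemma measurable_cons_section p (A : set (p.+1.-tuple T)) x :
  measurable A -> measurable [set t : p.-tuple T | A (cons_tuple x t)].
Proof.
by move=> mA; apply: (measurable_preimageT (f := cons_tuple x)) mA; exact: measurable_cons.
Qed.

Lemma measurable_prodm_section p (A : set (p.+1.-tuple T)) :
  measurable A ->
  measurable_fun setT (fun x => prodm nu [set t : p.-tuple T | A (cons_tuple x t)]).
Proof.
move=> mA; have [m mE] := prodm_probability p.
have -> : (fun x => prodm nu [set t : p.-tuple T | A (cons_tuple x t)]) =
    m \o xsection (@cons_pair T p @^-1` A).
  apply/funext => x /=; rewrite mE; last exact: measurable_cons_section.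
  by congr (m _); apply/seteqP; split=> t /=; rewrite /xsection /= inE.
apply: measurable_fun_xsection.
exact: (measurable_preimageT (@measurable_cons_pair _ _ _) mA).
Qed.

(** Induction on [p]: integrating over the first coordinate, the factor [prodm nu B] is a constant
    and leaves the integral. *)
Lemma prodm_cat p q (A : set (p.-tuple T)) (B : set (q.-tuple T)) :
  measurable A -> measurable B ->
  prodm nu [set t : (p + q).-tuple T | A [tuple tnth t (lshift q i) | i < p] /\
                                       B [tuple tnth t (rshift p i) | i < q]] =
  prodm nu A * prodm nu B.
Proof.
move=> mA mB; elim: p A mA => [|p IH] A mA.
  rewrite /=; case: asboolP => A0.
    rewrite mul1e; congr prodm; apply/seteqP; split=> t /=.
      move=> [_]; congr B.
      by apply: eq_from_tnth => i; rewrite tnth_mktuple; congr tnth; exact: val_inj.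
    move=> Bt; split; first by rewrite tuple0.
    move: Bt; congr B.
    by apply: eq_from_tnth => i; rewrite tnth_mktuple; congr tnth; exact: val_inj.
  rewrite mul0e; have [m mE] := prodm_probability q.
  rewrite [X in prodm nu X](_ : _ = set0) ?mE ?measure0 //.
  apply/seteqP; split=> // t /= [At _]; apply: A0.
  by rewrite -(tuple0 [tuple tnth t (lshift q i) | i < 0]).
have [m mE] := prodm_probability p; have [m' mE'] := prodm_probability q.
rewrite [prodm nu A * _]muleC /= -ge0_integralZl //; last 3 first.
- exact: measurable_prodm_section.
- by move=> x _; rewrite mE; [exact: measure_ge0|exact: measurable_cons_section].
- by rewrite mE' // measure_ge0.
apply: eq_integral => x _.
rewrite muleC -IH; last exact: measurable_cons_section.
congr prodm; apply/seteqP.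
have El t : [tuple tnth (cons_tuple x t) (lshift q i) | i < p.+1] =
    cons_tuple x [tuple tnth t (lshift q i) | i < p].
  apply: eq_from_tnth => i; rewrite tnth_mktuple.
  case: (unliftP ord0 i) => [j|] ->; last by rewrite !tnth0.
  rewrite tnthS tnth_mktuple -[RHS](tnthS x); congr tnth; exact: val_inj.
have Er t : [tuple tnth (cons_tuple x t) (rshift p.+1 i) | i < q] =
    [tuple tnth t (rshift p i) | i < q].
  apply: eq_from_tnth => i; rewrite !tnth_mktuple -[RHS](tnthS x).
  congr tnth; exact: val_inj.
by split=> t /=; rewrite El Er.
Qed.

(** Both sides are integrals of one function, the number of sets containing [t]. *)
Lemma sum_prodm_eq p (I J : Type) (s : seq I) (s' : seq J)
    (A : I -> set (p.-tuple T)) (B : J -> set (p.-tuple T)) :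
  (forall i, measurable (A i)) -> (forall j, measurable (B j)) ->
  (forall t, \sum_(i <- s) `[< A i t >] = \sum_(j <- s') `[< B j t >])%N ->
  \sum_(i <- s) prodm nu (A i) = \sum_(j <- s') prodm nu (B j).
Proof.
have [m mE] := prodm_probability p => mA mB ABE.
have sumE K (r : seq K) (D : K -> set (p.-tuple T)) : (forall i, measurable (D i)) ->
    \sum_(i <- r) prodm nu (D i) = \int[m]_t (\sum_(i <- r) `[< D i t >])%N%:R%:E.
  move=> mD; transitivity (\int[m]_t \sum_(i <- r) (\1_(D i) t)%:E).
    have mI i : measurable_fun setT (EFin \o (\1_(D i) : _ -> R)).
      exact/measurable_EFinP/measurable_indic.
    rewrite (ge0_integral_sum _ _ mI) //; last by move=> i t _; rewrite lee_fin.
    by apply: eq_bigr => i _; rewrite mE // integral_indic // setIT.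
  apply: eq_integral => t _; rewrite natr_sum sumEFin; congr _%:E.
by rewrite !sumE //; apply: eq_integral => t _; rewrite ABE.
Qed.

End PowerMeasure.

(** * Stone pairings with modelings *)

Section ModelingPairing.
Variables (R : realType) (d : measure_display) (T : measurableType d).
Variables (nu : probability T R) (adj : T -> T -> bool).
Hypothesis measurable_def :
  forall p (phi : formula void p), measurable (def_set adj (@of_void T) phi).

(** A modeling only guarantees measurability for the language of graphs. The rooted set is the
    preimage of the one defined by [unroot phi] under appending [v] to a tuple. *)
Lemma measurable_rooted_def v p (phi : formula unit p) :
  measurable (def_set adj (fun=> v) phi).
Proof.
pose f (t : p.-tuple T) := [tuple env_ext (tnth t) v i | i < p.+1].
have mf : measurable_fun setT f.
  apply/measurable_fun_tnthP => i.
  case: (unliftP ord_max i) => [j|] ->.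
    rewrite (_ : _ \o f = (@tnth p T)^~ j); first exact: measurable_tnth.
    by apply/funext => t /=; rewrite tnth_mktuple env_ext_lift.
  rewrite (_ : _ \o f = cst v); first exact: measurable_cst.
  by apply/funext => t /=; rewrite tnth_mktuple env_ext_max.
rewrite (_ : def_set _ _ _ = f @^-1` def_set adj (@of_void T) (unroot phi)).
  exact: (measurable_preimageT mf (measurable_def _)).
have fE t : tnth (f t) = env_ext (tnth t) v by apply/funext => i; rewrite tnth_mktuple.
by apply/seteqP; split=> t; rewrite /def_set /= fE sat_unroot.
Qed.

Section Generic.
Variables (C : Type) (ic : C -> T).
Hypothesis mC : forall p (phi : formula C p), measurable (def_set adj ic phi).

Lemma mpair_probability p (phi : formula C p) :
  exists m : probability (p.-tuple T) R, mpair nu adj ic phi = m (def_set adj ic phi).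
Proof.
by have [m mE] := prodm_probability nu p; exists m; rewrite -mE //; exact: mC.
Qed.

Lemma fineK_mpair p (phi : formula C p) :
  (fine (mpair nu adj ic phi))%:E = mpair nu adj ic phi.
Proof.
have [m ->] := mpair_probability phi; apply: fineK; apply: fin_num_measure; exact: mC.
Qed.

Lemma fine_mpair_ge0 p (phi : formula C p) : 0 <= fine (mpair nu adj ic phi).
Proof. by have [m ->] := mpair_probability phi; rewrite fine_ge0. Qed.

Lemma fine_mpair_le1 p (phi : formula C p) : fine (mpair nu adj ic phi) <= 1.
Proof.
rewrite -lee_fin fineK_mpair; have [m ->] := mpair_probability phi.
by apply: probability_le1; exact: mC.
Qed.

Lemma fine_mpair_FConj p q (phi : formula C p) (psi : formula C q) :
  fine (mpair nu adj ic (FConj phi psi)) =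
  fine (mpair nu adj ic phi) * fine (mpair nu adj ic psi).
Proof.
apply: EFin_inj; rewrite EFinM !fineK_mpair /mpair -prodm_cat //; congr prodm.
by apply/seteqP; split=> t; [move/sat_FConj_tuple|move=> ?; apply/sat_FConj_tuple].
Qed.
End Generic.

Lemma sum_mpair_FMore_in xi (s : seq T) k p (phi : formula unit p) :
  uniq s -> (forall v, sat adj (@of_void T) (fun=> v) xi <-> v \in s) ->
  (size s <= k)%N ->
  \sum_(v <- s) fine (mpair nu adj (fun=> v) phi) =
  \sum_(j < k) fine (mpair nu adj (@of_void T) (FMore_in xi j phi)).
Proof.
move=> us xis sk; apply: EFin_inj; rewrite -!sumEFin.
under eq_bigr do rewrite (fineK_mpair (measurable_rooted_def _)).
under [in RHS]eq_bigr do rewrite (fineK_mpair measurable_def).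
apply: sum_prodm_eq => [v|j|t].
- exact: measurable_rooted_def.
- exact: measurable_def.
- exact: sum_sat_FMore_in.
Qed.

End ModelingPairing.

(** * Enumeration of the rooted formulas *)

(** Equating a constant with itself works even for [p = 0], where there is no variable to use. *)
Definition FTrue C (c : C) p : formula C p := FEq (TConst _ c) (TConst _ c).

(** 0 codes Root and [j.+1] codes the variable [j]; out-of-range codes default to Root. *)
Definition decode_term p (i : nat) : term unit p :=
  if i is j.+1 then oapp (@TVar unit p) (TConst _ tt) (insub j) else TConst _ tt.

(** Generic trees are countable, so a surjection from them suffices; malformed trees go to a true
    formula. *)
Fixpoint decode (t : GenTree.tree nat) : forall p, formula unit p :=
  match t with
  | GenTree.Node 0 [:: GenTree.Leaf i; GenTree.Leaf j] =>
      fun p => FEq (decode_term p i) (decode_term p j)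
  | GenTree.Node 1 [:: GenTree.Leaf i; GenTree.Leaf j] =>
      fun p => FAdj (decode_term p i) (decode_term p j)
  | GenTree.Node 2 [:: u] => fun p => FNot (decode u p)
  | GenTree.Node 3 [:: u; v] => fun p => FAnd (decode u p) (decode v p)
  | GenTree.Node 4 [:: u] => fun p => FEx (decode u p.+1)
  | _ => FTrue tt
  end.

Lemma decode_surj p (phi : formula unit p) : exists t, decode t p = phi.
Proof.
have term_surj q (u : term unit q) : exists i, decode_term q i = u.
  case: u => [i|[]]; last by exists 0.
  by exists i.+1; rewrite /= valK.
elim: phi => {p} [p t u|p t u|p f [a <-]|p f [a <-] g [b <-]|p f [a <-]].
- have [[i <-] [j <-]] := (term_surj _ t, term_surj _ u).
  by exists (GenTree.Node 0 [:: GenTree.Leaf i; GenTree.Leaf j]).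
- have [[i <-] [j <-]] := (term_surj _ t, term_surj _ u).
  by exists (GenTree.Node 1 [:: GenTree.Leaf i; GenTree.Leaf j]).
- by exists (GenTree.Node 2 [:: a]).
- by exists (GenTree.Node 3 [:: a; b]).
- by exists (GenTree.Node 4 [:: a]).
Qed.

Local Notation rooted_formula := {p & formula unit p}.

Definition nth_formula (m : nat) : rooted_formula :=
  if unpickle m is Some (p, t) then existT _ p (decode t p) else existT _ 0 (FTrue tt 0).

Lemma nth_formula_surj p (phi : formula unit p) : exists m, nth_formula m = existT _ p phi.
Proof.
have [t <-] := decode_surj phi.
by exists (pickle (p, t)); rewrite /nth_formula pickleK.
Qed.

(** * Polynomials in pairings, and approximation of finitely many pairings *)

Section Representable.
Variable R : realType.
Implicit Types (X : rooted_formula -> R) (f g : (rooted_formula -> R) -> R).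

Definition multiplicative_pairing X :=
  X (existT _ 0 (FTrue tt 0)) = 1 /\
  forall a b : rooted_formula,
    X (existT _ _ (FConj (projT2 a) (projT2 b))) = X a * X b.

(** On multiplicative pairings [f] is a linear combination of evaluations, with coefficients
    independent of [X]. *)
Definition representable f :=
  exists l : seq (R * rooted_formula),
    forall X, multiplicative_pairing X -> f X = \sum_(x <- l) x.1 * X x.2.

Lemma representable_cst c : representable (fun=> c).
Proof.
exists [:: (c, existT _ 0 (FTrue tt 0))] => X [X1 _].
by rewrite big_seq1 /= X1 mulr1.
Qed.

Lemma representable_eval a : representable (fun X => X a).
Proof. by exists [:: (1, a)] => X _; rewrite big_seq1 mul1r. Qed.

Lemma representableD f g :
  representable f -> representable g -> representable (fun X => f X + g X).
Proof.
by move=> [l fl] [l' gl]; exists (l ++ l') => X mX; rewrite big_cat fl ?gl.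
Qed.

(** A product of two evaluations is the evaluation at [FConj], so products stay linear. *)
Lemma representableM f g :
  representable f -> representable g -> representable (fun X => f X * g X).
Proof.
move=> [l fl] [l' gl].
exists [seq (x.1 * y.1, existT _ _ (FConj (projT2 x.2) (projT2 y.2)))
       | x <- l, y <- l'] => X mX.
rewrite big_allpairs_dep /= fl // gl // mulr_suml; apply: eq_bigr => x _.
rewrite mulr_sumr; apply: eq_bigr => y _.
by rewrite mX.2 mulrACA.
Qed.

Lemma representableX f n : representable f -> representable (fun X => f X ^+ n).
Proof.
move=> rf; elim: n => [|n IH]; first exact: representable_cst.
rewrite (_ : (fun X => _) = fun X => f X * f X ^+ n); first exact: representableM.
by apply/funext => X; rewrite exprS.
Qed.

Lemma representable_sum m (F : nat -> (rooted_formula -> R) -> R) :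
  (forall i, representable (F i)) -> representable (fun X => \sum_(i < m) F i X).
Proof.
move=> rF; elim: m => [|m IH].
  rewrite (_ : (fun X => _) = fun=> 0); first exact: representable_cst.
  by apply/funext => X; rewrite big_ord0.
rewrite (_ : (fun X => _) = fun X => \sum_(i < m) F i X + F m X); first exact: representableD.
by apply/funext => X; rewrite big_ord_recr.
Qed.

Section Limit.
Variables (V : nat -> eqType) (U : eqType).
Variables (s_ : forall n, seq (V n)) (s : seq U).
Variables (X_ : forall n, V n -> rooted_formula -> R) (X : U -> rooted_formula -> R).
Hypothesis X_mul : forall n (v : V n), multiplicative_pairing (X_ v).
Hypothesis X_01 : forall n (v : V n) a, 0 <= X_ v a <= 1.
Hypothesis Xmul : forall v, multiplicative_pairing (X v).
Hypothesis X01 : forall v a, 0 <= X v a <= 1.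
Hypothesis sum_cvg : forall a,
  (fun n => \sum_(v <- s_ n) X_ v a) @ \oo --> \sum_(v <- s) X v a.

(** By linearity the sum over [v] moves inside, where [sum_cvg] handles each formula. *)
Lemma representable_sum_cvg f : representable f ->
  (fun n => \sum_(v <- s_ n) f (X_ v)) @ \oo --> \sum_(v <- s) f (X v).
Proof.
move=> [l fl].
have sumE (W : Type) (r : seq W) (Y : W -> rooted_formula -> R) :
    (forall w, multiplicative_pairing (Y w)) ->
    \sum_(w <- r) f (Y w) = \sum_(x <- l) x.1 * \sum_(w <- r) Y w x.2.
  move=> mY; rewrite (eq_bigr _ (fun w _ => fl _ (mY w))) exchange_big /=.
  by apply: eq_bigr => x _; rewrite mulr_sumr.
rewrite sumE //; under eq_cvg do rewrite sumE //.
apply: cvg_big => [|x _]; first exact: add_continuous.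
by apply: cvgM; [exact: cvg_cst|exact: sum_cvg].
Qed.

(** If all vertices were far from [r], the sum of [f] over [s_ n] would be at most [q ^+ N * k],
    below 1/2, although its limit is at least 1. *)
Lemma exists_approx k r (a : nat -> rooted_formula) m (e : R) :
  (\forall n \near \oo, (size (s_ n) <= k)%N) -> r \in s -> 0 < e ->
  \forall n \near \oo, exists v : V n, forall i, (i < m)%N -> `|X_ v (a i) - X r (a i)| < e.
Proof.
(* [M] bounds [Q] and is positive even for [m = 0]; capping [d] at 1 makes [q] below nonnegative. *)
move=> sk rs e0; pose d := Num.min e 1; pose M := m.+1%:R : R.
have d0 : 0 < d by rewrite lt_min e0 ltr01.
have M0 : 0 < M by rewrite ltr0n.
pose Q (Y : rooted_formula -> R) := \sum_(i < m) (Y (a i) - X r (a i)) ^+ 2.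
have Q0 Y : 0 <= Q Y by apply: sumr_ge0 => i _; exact: sqr_ge0.
have QM Y : (forall b, 0 <= Y b <= 1) -> Q Y <= M.
  move=> Y01; rewrite /M -natr1 (@le_trans _ _ m%:R) ?lerDl //.
  rewrite -[X in X%:R]card_ord -sum1_card natr_sum.
  apply: ler_sum => i _.
  by move: (Y01 (a i)) (X01 r (a i)) => /andP[? ?] /andP[? ?]; nra.
have Qr : Q (X r) = 0 by rewrite /Q big1 // => i _; rewrite subrr expr0n.
pose q := 1 - d ^+ 2 / M.
have dM : d ^+ 2 / M <= 1.
  rewrite ler_pdivrMr // mul1r (@le_trans _ _ 1) ?ler1n //.
  by rewrite exprn_ile1 ?(ltW d0) // ge_min lexx orbT.
have q0 : 0 <= q by rewrite subr_ge0.
have [N qN] : exists N, q ^+ N * k%:R < 2^-1.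
  have q1 : `|q| < 1 by rewrite ger0_norm // ltrBlDr ltrDl divr_gt0 ?exprn_gt0.
  have : (fun n => q ^+ n * k%:R) @ \oo --> (0 * k%:R : R).
    by apply: cvgM; [exact: cvg_expr|exact: cvg_cst].
  rewrite mul0r => /cvgrPdist_lt /(_ 2^-1).
  rewrite invr_gt0 ltr0n => /(_ isT) [N _ /(_ N (leqnn N))] /=.
  by rewrite sub0r normrN ger0_norm ?mulr_ge0 ?exprn_ge0 // => ?; exists N.
pose f (Y : rooted_formula -> R) := (1 - Q Y / M) ^+ N.
have rf : representable f.
  apply: representableX; apply: representableD; first exact: representable_cst.
  rewrite (_ : (fun Y => _) = fun Y => Q Y * - M^-1); last first.
    by apply/funext => Y; rewrite mulrN.
  apply: representableM; last exact: representable_cst.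
  apply: (@representable_sum m (fun i Y => (Y (a i) - X r (a i)) ^+ 2)) => i.
  apply: representableX; apply: representableD; last exact: representable_cst.
  exact: representable_eval.
have f0 Y : (forall b, 0 <= Y b <= 1) -> 0 <= f Y.
  move=> Y01; rewrite exprn_ge0 // subr_ge0 ler_pdivrMr // mul1r; exact: QM.
(* The term of [r] alone is 1, as [Q] vanishes there. *)
have sf : 1 <= \sum_(v <- s) f (X v).
  rewrite (big_rem r) //= {1}/f Qr mul0r subr0 expr1n lerDl.
  by apply: sumr_ge0 => v _; apply: f0.
have /cvgrPdist_lt /(_ 2^-1) := representable_sum_cvg rf.
rewrite invr_gt0 ltr0n => /(_ isT) near_f.
near=> n.
have sumf : 2^-1 < \sum_(v <- s_ n) f (X_ v).
  have : `|\sum_(v <- s) f (X v) - \sum_(v <- s_ n) f (X_ v)| < 2^-1 by near: n.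
  rewrite ltr_norml => /andP[_]; move: sf; lra.
have skn : (size (s_ n) <= k)%N by near: n.
apply: contrapT => /forallNP far.
suff : \sum_(v <- s_ n) f (X_ v) <= q ^+ N * k%:R.
  by move=> /(lt_le_trans sumf) /lt_trans /(_ qN); rewrite ltxx.
rewrite (@le_trans _ _ (\sum_(v <- s_ n) q ^+ N)) //; last first.
  rewrite big_const_seq count_predT iter_addr_0 -[leLHS]mulr_natr.
  by rewrite ler_wpM2l ?exprn_ge0 // ler_nat.
apply: ler_sum => v _; apply: lerXn2r; rewrite ?nnegrE //.
  by rewrite subr_ge0 ler_pdivrMr // mul1r; exact: QM.
rewrite lerD2l lerN2 ler_pM2r ?invr_gt0 //.
(* One index off by at least [e] already makes [Q] at least [d ^+ 2]. *)
have /existsNP[i /not_implyP[im /negP]] := far v; rewrite -leNgt => ie.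
rewrite /Q (bigD1 (Ordinal im)) //= -[leLHS]addr0 lerD ?sumr_ge0 //; last first.
  by move=> j _; exact: sqr_ge0.
rewrite -[leRHS]real_normK ?num_real // lerXn2r ?nnegrE ?(ltW d0) //.
by rewrite (le_trans _ ie) // ge_min lexx.
Unshelve. all: end_near.
Qed.

End Limit.
End Representable.

(** * Diagonal choice and construction of the roots *)

(** For each [n], take a witness for the largest attainable level [m <= n]; the cap [n] makes the
    maximum exist and still tends to infinity. *)
Lemma diagonal_choice (V : nat -> Type) (P : nat -> forall n, V n -> Prop) :
  (forall m m' n (v : V n), (m <= m')%N -> P m' n v -> P m n v) ->
  (forall n, exists v, P 0 n v) ->
  (forall m, \forall n \near \oo, exists v, P m n v) ->
  exists rs : forall n, V n, forall m, \forall n \near \oo, P m n (rs n).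
Proof.
move=> Pmono P0 Pnear.
have max_ex n : exists v : V n, forall m, (m <= n)%N -> (exists w, P m n w) -> P m n v.
  pose E m := (m <= n)%N && `[< exists w, P m n w >].
  have E0 : exists m, E m by exists 0; apply/asboolP.
  have En m : E m -> (m <= n)%N by case/andP.
  case: (ex_maxnP E0 En) => m /andP[_ /asboolP[v Pv]] mmax.
  exists v => m' m'n Pm'; apply: Pmono Pv; apply: mmax.
  by rewrite /E m'n; exact/asboolP.
exists (fun n => projT1 (cid (max_ex n))) => m.
near=> n; case: cid => v /= ; apply; first by near: n; exact: nbhs_infty_ge.
by near: n; exact: Pnear.
Unshelve. all: end_near.
Qed.

Section Rooting.
Variables (R : realType) (G : nat -> fingraph).
Variables (d : measure_display) (T : measurableType d) (nu : probability T R).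
Variables (adj : T -> T -> bool) (r : T).
Hypothesis G0 : forall n, (0 < #|fg_V (G n)|)%N.
Hypothesis measurable_def :
  forall p (phi : formula void p), measurable (def_set adj (@of_void T) phi).
Hypothesis lim : modeling_limit G nu adj.

Let pairG n (v : fg_V (G n)) (a : rooted_formula) : R := fpair R (fun=> v) (projT2 a).
Let pairL (v : T) (a : rooted_formula) : R := fine (mpair nu adj (fun=> v) (projT2 a)).

Lemma fpair_cvg_fine p (phi : formula void p) :
  (fun n => fpair R (@of_void (fg_V (G n))) phi) @ \oo -->
  fine (mpair nu adj (@of_void T) phi).
Proof.
have := @lim p phi; rewrite -(fineK_mpair nu measurable_def phi).
by move/fine_cvgP => [].
Qed.

(** The sentence stating that [xi] has more than [size s] solutions is false in the limit; its
    pairings are 0 or 1 and tend to 0, so they are eventually 0. *)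
Lemma card_algebraic_le (xi : formula void 1) (s : seq T) :
  uniq s -> (forall v, sat adj (@of_void T) (fun=> v) xi <-> v \in s) ->
  \forall n \near \oo,
    (count (fun v => `[< sat (@fg_adj (G n)) (@of_void _) (fun=> v) xi >])
       (enum (fg_V (G n))) <= size s)%N.
Proof.
move=> us xis.
have extE V (e : 'I_0 -> V) v : env_ext e v = fun=> v.
  by apply/funext => i; rewrite (ord1 i) -(ord1 ord_max) env_ext_max.
have L0 : fine (mpair nu adj (@of_void T) (FMore (size s) xi)) = 0.
  rewrite /mpair /=; case: asboolP => // more.
  have in_s v : sat adj (@of_void T) (env_ext (tnth [tuple]) v) xi -> v \in s.
    by rewrite extE => /xis.
  by move/(sat_FMore _ us in_s): more; rewrite ltnNge count_size.
have := @fpair_cvg_fine 0 (FMore (size s) xi).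
rewrite L0 => /cvgrPdist_lt /(_ 1 ltr01); apply: filterS => n.
rewrite sub0r normrN fpair0.
case: asboolP => [|nsat _]; first by rewrite normr1 ltxx.
rewrite leqNgt; apply/negP => lt_s; apply: nsat.
apply/(sat_FMore _ (enum_uniq _)) => [v _|]; first by rewrite mem_enum.
by under eq_count do rewrite extE.
Qed.

Lemma exists_roots : algebraic_vertex adj r ->
  exists rs : forall n, fg_V (G n), forall p (phi : formula unit p),
    (fun n => fpair R (fun=> rs n) phi) @ \oo --> fine (mpair nu adj (fun=> r) phi).
Proof.
move=> [xi [fin_xi xi_r]].
have [s [us xis]] : exists s : seq T, uniq s /\
    forall v, sat adj (@of_void T) (fun=> v) xi <-> v \in s.
  have tupE v : tnth [tuple v] = fun=> v.
    by apply/funext => i; rewrite (ord1 i).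
  have : finite_set [set v | sat adj (@of_void T) (fun=> v) xi].
    apply: sub_finite_set (finite_image (fun t => thead t) fin_xi) => v /= xiv.
    by exists [tuple v]; rewrite /def_set /= ?tupE.
  move=> /finite_seqP[s sE]; exists (undup s); split; first exact: undup_uniq.
  by move=> v; have /= -> := congr1 (fun A => A v) sE; rewrite mem_undup.
have rs : r \in s.
  apply/xis; move: xi_r; rewrite /def_set /=.
  by rewrite (_ : tnth [tuple r] = fun=> r) //; apply/funext => i; rewrite (ord1 i).
pose P n v := `[< sat (@fg_adj (G n)) (@of_void _) (fun=> v) xi >].
pose s_ n := seq.filter (@P n) (enum (fg_V (G n))).
have s_k : \forall n \near \oo, (size (s_ n) <= size s)%N.
  by under eq_near do rewrite size_filter; exact: card_algebraic_le.
have s_xi n v : sat (@fg_adj (G n)) (@of_void _) (fun=> v) xi <-> v \in s_ n.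
  by rewrite mem_filter mem_enum andbT; split=> [/asboolP|/asboolP].
(* Both sums become sums of unrooted pairings, which converge by hypothesis; in [G n] this needs at
   most [size s] solutions of [xi], hence only holds eventually. *)
have sum_cvg a : (fun n => \sum_(v <- s_ n) pairG v a) @ \oo --> \sum_(v <- s) pairL v a.
  rewrite /pairL (sum_mpair_FMore_in nu measurable_def _ us xis (leqnn _)).
  have FMore_cvg : (fun n => \sum_(j < size s)
      fpair R (@of_void (fg_V (G n))) (FMore_in xi j (projT2 a))) @ \oo -->
      \sum_(j < size s) fine (mpair nu adj (@of_void T) (FMore_in xi j (projT2 a))).
    by apply: cvg_big => [|j _]; [exact: add_continuous|exact: fpair_cvg_fine].
  apply: cvg_trans FMore_cvg; apply: near_eq_cvg.
  apply: filterS s_k => n s_nk; symmetry; apply: sum_fpair_FMore_in => //.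
  exact/filter_uniq/enum_uniq.
have mulG n (v : fg_V (G n)) : multiplicative_pairing (pairG v).
  split=> [|a b]; last exact: fpair_FConj.
  by rewrite /pairG fpair0 (_ : `[< _ >] = true) //; exact/asboolP.
have mulL v : multiplicative_pairing (pairL v).
  split=> [|a b]; last exact: (fine_mpair_FConj nu (measurable_rooted_def measurable_def v)).
  by rewrite /pairL /mpair /= (_ : `[< _ >] = true) //; exact/asboolP.
have pG01 n (v : fg_V (G n)) a : 0 <= pairG v a <= 1 by rewrite fpair_ge0 fpair_le1.
have pL01 v a : 0 <= pairL v a <= 1.
  by rewrite fine_mpair_ge0 ?fine_mpair_le1 //; exact: measurable_rooted_def.
(* Level [m] asks for precision [1 / (m + 1)] on the first [m] formulas; level 0 is vacuous, so any
   vertex attains it. *)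
pose Q m n (v : fg_V (G n)) := forall i, (i < m)%N ->
  `|pairG v (nth_formula i) - pairL r (nth_formula i)| < m.+1%:R^-1.
have Qmono m m' n (v : fg_V (G n)) : (m <= m')%N -> Q m' n v -> Q m n v.
  move=> mm' Qv i im; apply: (lt_le_trans (Qv i (leq_trans im mm'))).
  by rewrite lef_pV2 ?posrE ?ltr0n // ler_nat.
have Q0 n : exists v, Q 0 n v.
  by have /card_gt0P[v _] := G0 n; exists v.
have Qnear m : \forall n \near \oo, exists v, Q m n v.
  by apply: (exists_approx mulG pG01 mulL pL01 sum_cvg) s_k rs _; rewrite invr_gt0.
have [w Qw] := diagonal_choice Qmono Q0 Qnear.
exists w => p phi; have [i iE] := nth_formula_surj phi.
apply/cvgrPdist_lt => e e0.
near=> n; rewrite distrC.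
(* Large enough to include formula [i] and to make the precision at most [e]. *)
pose m := maxn i.+1 (Num.truncn e^-1).+1.
have Qn : Q m n (w n) by near: n; exact: Qw.
have := Qn i (leq_maxl _ _).
rewrite iE /pairG /pairL /= => /lt_le_trans; apply.
rewrite invf_ple ?posrE ?ltr0n //.
rewrite (le_trans (ltW (truncnS_gt _))) // ler_nat.
by rewrite (leq_trans (leq_maxr i.+1 _)).
Unshelve. all: end_near.
Qed.
End Rooting.

Theorem theorem1 (R : realType) (G : nat -> fingraph)
    (d : measure_display) (T : measurableType d) (nu : probability T R)
    (adj : T -> T -> bool) (r : T) :
  (forall n, is_fingraph (G n)) ->
  FO_convergent R G ->
  is_modeling nu adj ->
  modeling_limit G nu adj ->
  algebraic_vertex adj r ->
  exists rs : forall n, fg_V (G n),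
    forall p (phi : formula unit p),
      (fun n => (fpair R (fun _ : unit => rs n) phi)%:E) @ \oo
        --> mpair nu adj (fun _ : unit => r) phi.
Proof.
move=> G_graph _ [_ _ mdef] lim alg.
have [rs rs_cvg] := exists_roots (fun n => (G_graph n).2) mdef lim alg.
(* The limit pairing is finite, so real convergence lifts to the extended reals. *)
exists rs => p phi; rewrite -(fineK_mpair nu (measurable_rooted_def mdef r) phi).
by apply: cvg_EFin; [exact: nearW|exact: rs_cvg].
Qed.
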